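(* Let $p$ be a prime, $K$ a field of characteristic $p$, and $q$ a power of $p$ ($q=p^\lambda$ with $\lambda\ge 1$). Then for all $\gamma\in\Gamma_{q,K}$ and all $F\in K[[X]]^\times$, $$\psi_q[\mathbf{D}[F\circ\gamma]]=\gamma^{-1}\circ\psi_q[\mathbf{D}[F]],$$ where $\gamma^{-1}$ denotes the inverse of $\gamma$ under composition of power series.
   Context: $\mathbb{N}$ is the set of positive integers. For $n\in\mathbb{N}$, $\mathrm{ord}_p n$ is the exact order with which $p$ divides $n$. $\Gamma_{q,K}$ is the group, under composition of power series, of all power series of the form $X+\sum_{i=1}^\infty a_iX^{q^i}$ with $a_i\in K$. $K[[X]]^\times$ is the group of units of the commutative power series ring $K[[X]]$. For $F=F(X)\in K[[X]]^\times$ put $\mathbf{D}[F]=XF'(X)/F(X)\in XK[[X]]$. For $c\in\mathbb{N}$ let $$O_q(c)=\{n\in\mathbb{N} : \gcd(n,p)=1 \text{ and } n\equiv p^ic \bmod (q-1) \text{ for some } i\in\mathbb{N}\cup\{0\}\}.$$ Let $$C_q^0=\left\{c\in\mathbb{N}\cap(0,q) : \gcd(c,p)=1 \text{ and } \frac{c+1}{p^{\mathrm{ord}_p(c+1)}}=\min_{n\in O_q(c)\cap(0,q)}\frac{n+1}{p^{\mathrm{ord}_p(n+1)}}\right\},$$ $$C_q=\bigcup_{c\in C_q^0}\{q^i(c+1)-1 : i\in\mathbb{N}\cup\{0\}\}.$$ The map $\psi_q:XK[[X]]\to X^2K[[X]]$ is the additive homomorphism defined by $\psi_q\left[\sum_{i=1}^\infty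 a_iX^i\right]=X\cdot\sum_{k\in C_q}a_kX^k$. *)

(* Defs.v *)
From HB Require Import structures.
From mathcomp Require Import all_boot all_order all_algebra.
From mathcomp Require Import boolp classical_sets.

Set Implicit Arguments.
Unset Strict Implicit.
Unset Printing Implicit Defensive.

Import GRing.Theory.
Local Open Scope ring_scope.


Record fps (K : Type) := FPS { fps_coef :> nat -> K }.

HB.instance Definition _ (K : Type) := gen_eqMixin (fps K).
HB.instance Definition _ (K : Type) := gen_choiceMixin (fps K).

Lemma fpsP (K : Type) (f g : fps K) : f =1 g <-> f = g.
Proof.
by split=> [|->//]; case: f g => [f] [g] /= efg; congr FPS; apply/funext.
Qed.

Section FpsRing.
Variable K : comNzRingType.
Implicit Types f g h : fps K.

Definition fps_zero : fps K := FPS (fun _ => 0).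
Definition fps_opp f : fps K := FPS (fun n => - f n).
Definition fps_add f g : fps K := FPS (fun n => f n + g n).
Definition fps_one : fps K := FPS (fun n => (n == 0%N)%:R).
Definition fps_mul f g : fps K :=
  FPS (fun n => \sum_(i < n.+1) f i * g (n - i)%N).

Definition fps_trunc (m : nat) f : {poly K} := \poly_(i < m) f i.

Lemma coef_fps_trunc m f n : (n < m)%N -> (fps_trunc m f)`_n = f n.
Proof. by move=> nm; rewrite coef_poly nm. Qed.

Fact fps_addA : associative fps_add.
Proof. by move=> f g h; apply/fpsP => n /=; rewrite addrA. Qed.
Fact fps_addC : commutative fps_add.
Proof. by move=> f g; apply/fpsP => n /=; rewrite addrC. Qed.
Fact fps_add0 : left_id fps_zero fps_add.
Proof. by move=> f; apply/fpsP => n /=; rewrite add0r. Qed.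
Fact fps_addN : left_inverse fps_zero fps_opp fps_add.
Proof. by move=> f; apply/fpsP => n /=; rewrite addNr. Qed.

HB.instance Definition _ :=
  GRing.isZmodule.Build (fps K) fps_addA fps_addC fps_add0 fps_addN.

Lemma fps_mul_trunc f g m n : (n < m)%N ->
  fps_mul f g n = (fps_trunc m f * fps_trunc m g)`_n.
Proof.
move=> nm /=; rewrite coefM; apply: eq_bigr => i _.
rewrite !coef_fps_trunc //; first exact: leq_ltn_trans (leq_subr _ _) nm.
exact: leq_trans (ltn_ord i) nm.
Qed.

Fact fps_mulC : commutative fps_mul.
Proof.
move=> f g; apply/fpsP => n.
by rewrite !(fps_mul_trunc _ _ (ltnSn n)) mulrC.
Qed.

Fact fps_mulA : associative fps_mul.
Proof.
move=> f g h; apply/fpsP => n.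
set T := fps_trunc n.+1.
transitivity ((T f * (T g * T h))`_n).
  rewrite coefM; apply: eq_bigr => i _.
  by rewrite coef_fps_trunc // -fps_mul_trunc // ltnS leq_subr.
rewrite mulrA coefM; apply: eq_bigr => i _.
by rewrite -fps_mul_trunc // coef_fps_trunc // ltnS leq_subr.
Qed.

Fact fps_mul1 : left_id fps_one fps_mul.
Proof.
move=> f; apply/fpsP => n /=.
rewrite big_ord_recl /= mul1r subn0 big1 ?addr0 // => i _.
by rewrite mul0r.
Qed.

Fact fps_mulDl : left_distributive fps_mul fps_add.
Proof.
move=> f g h; apply/fpsP => n /=; rewrite -big_split /=.
by apply: eq_bigr => i _; rewrite mulrDl.
Qed.

Fact fps_one_neq0 : fps_one != 0.
Proof.
by apply/eqP => /fpsP/(_ 0%N) /= /eqP; rewrite oner_eq0.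
Qed.

HB.instance Definition _ := GRing.Zmodule_isComNzRing.Build (fps K)
  fps_mulA fps_mulC fps_mul1 fps_mulDl fps_one_neq0.

Definition fps_unit : {pred fps K} := fun f => `[< exists g, g * f = 1 >].
Definition fps_inv f : fps K := xget f [set g | g * f = 1].

Fact fps_mulV : {in fps_unit, left_inverse 1 fps_inv *%R}.
Proof. by move=> f /asboolP uf; exact: (@xgetPex _ f [set g | g * f = 1]). Qed.
Fact fps_unitP f g : g * f = 1 -> fps_unit f.
Proof. by move=> gf; apply/asboolP; exists g. Qed.
Fact fps_inv_out : {in [predC fps_unit], fps_inv =1 id}.
Proof.
by move=> f /asboolP nf; apply: xgetPN => g gf; apply: nf; exists g.
Qed.

HB.instance Definition _ := GRing.ComNzRing_hasMulInverse.Build (fps K)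
  fps_mulV fps_unitP fps_inv_out.

Lemma fpsE :
  ((forall n, (0 : fps K) n = 0) * (forall n, (1 : fps K) n = (n == 0%N)%:R)
   * (forall f n, ((- f) n = - f n)%R) * (forall f g n, ((f + g) n = f n + g n)%R)
   * (forall f g n, ((f * g) n = \sum_(i < n.+1) f i * g (n - i)%N)%R))%type.
Proof. by []. Qed.

Definition fps_X : fps K := FPS (fun n => (n == 1%N)%:R).

Definition fps_deriv f : fps K := FPS (fun n => f n.+1 *+ n.+1).

(** [fps_comp f g] is f(g(X)); it is only meaningful when [g 0 = 0], in which
    case g^i has no term of degree < i and the sum below is the full one. *)
Definition fps_comp f g : fps K :=
  FPS (fun n => \sum_(i < n.+1) f i * (g ^+ i) n).

(** The inverse under composition, and [fps_X] by default when there is none;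
    see [fps_compK], [fps_compVK] and [fps_comp_inv_unique]. *)
Definition fps_comp_inv f : fps K :=
  xget fps_X
    [set g : fps K | [/\ g 0%N = 0, fps_comp f g = fps_X & fps_comp g f = fps_X]].

Definition fps_dlog f : fps K := fps_X * fps_deriv f / f.

(** Membership in [Gamma_{q,K}], for q > 1: since i < q ^ i, the coefficient
    of X ^ n in the sum of the a_i X ^ (q ^ i) only involves indices i <= n. *)
Definition in_Gamma (q : nat) f : Prop :=
  exists a : nat -> K, forall n,
    f n = fps_X n + \sum_(1 <= i < n.+1 | n == (q ^ i)%N) a i.

End FpsRing.

Arguments fps_X {K}.

Infix "\oX" := fps_comp (at level 50, left associativity) : ring_scope.


Definition O_set (p q c : nat) : set nat :=
  [set n | [/\ (0 < n)%N, coprime n p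
             & exists i, n = p ^ i * c %[mod q - 1]]].

Definition succ_p'part (p n : nat) : nat := n.+1 %/ p ^ logn p n.+1.

Definition is_minimum (A : set nat) (m : nat) : Prop :=
  A m /\ forall n, A n -> (m <= n)%N.

Definition C0_set (p q : nat) : set nat :=
  [set c | [/\ (0 < c < q)%N, coprime c p
             & is_minimum
                 [set m | exists n, [/\ O_set p q c n, (0 < n < q)%N
                                      & m = succ_p'part p n]]
                 (succ_p'part p c)]].

Definition C_set (p q : nat) : set nat :=
  [set k | exists c i, C0_set p q c /\ k = (q ^ i * c.+1 - 1)%N].

(** Defined on all of K[[X]]; as [0] is not in [C_set p q] the constant term
    is ignored. *)
Definition psi (p q : nat) (K : comNzRingType) (f : fps K) : fps K :=
  fps_X * FPS (fun k => if k \in C_set p q then f k else 0).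


Lemma fps_rec (T : Type) (x0 : T) (step : nat -> (nat -> T) -> T) :
  (forall n u v, (forall i, (i < n)%N -> u i = v i) -> step n u = step n v) ->
  exists u : nat -> T, forall n, u n = step n u.
Proof.
move=> stepP.
pose s := fix s n := if n is m.+1 then rcons (s m) (step m (nth x0 (s m))) else [::].
have sz n : size (s n) = n by elim: n => //= n IH; rewrite size_rcons IH.
have sE m n : (n < m)%N -> nth x0 (s m) n = step n (nth x0 (s n)).
  elim: m => // m IH; rewrite ltnS leq_eqVlt /= nth_rcons sz.
  by case/predU1P=> [->|nm]; [rewrite ltnn eqxx | rewrite nm IH].
exists (fun n => nth x0 (s n.+1) n) => n; rewrite sE //.
by apply: stepP => i ilt; rewrite !sE.
Qed.

Section FpsTheory.
Variable K : comNzRingType.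
Implicit Types f g h : fps K.

Lemma fps_unitE f : (f \is a GRing.unit) = `[< exists c, c * f 0%N = 1 >].
Proof.
apply/idP/asboolP => [uf | [c cf]].
  exists (f^-1 0%N); have /fpsP/(_ 0%N) := mulVr uf.
  by rewrite !fpsE big_ord1 subnn.
pose step n (u : nat -> K) :=
  c * ((n == 0%N)%:R - \sum_(i < n) u i * f (n - i)%N).
have [|u uE] := @fps_rec K 0 step.
  move=> n u v uv; congr (_ * (_ - _)); apply: eq_bigr => i _.
  by rewrite uv.
apply/asboolP; exists (FPS u); apply/fpsP => n; rewrite !fpsE big_ord_recr /=.
by rewrite subnn uE /step mulrAC cf mul1r addrC subrK.
Qed.

Lemma fps_exp_trunc g m i n : (n < m)%N ->
  (g ^+ i) n = (fps_trunc m g ^+ i)`_n.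
Proof.
elim: i n => [|i IH] n nm; first by rewrite !expr0 coef1.
rewrite !exprS fpsE coefM; apply: eq_bigr => j _.
rewrite coef_fps_trunc ?IH //; first exact: leq_ltn_trans (leq_subr _ _) nm.
exact: leq_trans (ltn_ord j) nm.
Qed.

Lemma fps_exp_lt g i n : g 0%N = 0 -> (n < i)%N -> (g ^+ i) n = 0.
Proof.
move=> g0; elim: i n => // i IH n ni; rewrite exprS fpsE.
apply: big1 => -[[|j] jn] _ /=; first by rewrite g0 mul0r.
by rewrite IH ?mulr0 //; case: n ni jn => // n ni jn; rewrite subSS (leq_ltn_trans (leq_subr _ _)).
Qed.

Lemma fps_exp_diag g n : g 0%N = 0 -> (g ^+ n) n = g 1%N ^+ n.
Proof.
move=> g0; elim: n => [//|n IH]; rewrite exprS fpsE.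
rewrite big_ord_recl /= g0 mul0r add0r big_ord_recl /= subSS subn0 IH exprS.
rewrite big1 ?addr0 // => i _; rewrite fps_exp_lt ?mulr0 //.
by rewrite /bump /= !add1n subSS; case: n {IH} i => [[]//|n] i; rewrite subSS ltnS leq_subr.
Qed.

Lemma fps_comp_poly (P : {poly K}) f h m n : h 0%N = 0 -> (n < m)%N ->
    (forall i, (i <= n)%N -> P`_i = f i) ->
  (f \oX h) n = (P \Po fps_trunc m h)`_n.
Proof.
move=> h0 nm Pf; rewrite coef_comp_poly /=.
set F := fun i => P`_i * (fps_trunc m h ^+ i)`_n.
have Fhi i : (n < i)%N -> F i = 0.
  by move=> ni; rewrite /F -fps_exp_trunc // fps_exp_lt // mulr0.
have Fsz i : (size P <= i)%N -> F i = 0.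
  by move=> ni; rewrite /F nth_default // mul0r.
transitivity (\sum_(i < n.+1) F i).
  by apply: eq_bigr => i _; rewrite /F Pf -1?ltnS // -fps_exp_trunc.
pose N := maxn n.+1 (size P).
have widen k : (k <= N)%N -> (forall i, (k <= i)%N -> F i = 0) ->
    \sum_(i < k) F i = \sum_(i < N) F i.
  move=> kN Fk; rewrite -!(big_mkord xpredT) [RHS](big_cat_nat (n := k)) //=.
  rewrite [X in _ = _ + X]big_nat_cond [X in _ = _ + X]big1 ?addr0 //.
  by move=> i /andP[/andP[/Fk]].
by rewrite !widen ?leq_maxl ?leq_maxr.
Qed.

Lemma fps_comp0 f g : (f \oX g) 0%N = f 0%N.
Proof. by rewrite /= big_ord1 expr0 fpsE mulr1. Qed.

Lemma fps_compM f g h : h 0%N = 0 -> (f * g) \oX h = (f \oX h) * (g \oX h).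
Proof.
move=> h0; apply/fpsP => n; pose T := @fps_trunc K n.+1.
rewrite (@fps_comp_poly (T f * T g) _ _ n.+1) //; last first.
  by move=> i ni; rewrite -fps_mul_trunc.
rewrite comp_polyM coefM fpsE; apply: eq_bigr => i _.
have le_i : (i <= n)%N by rewrite -ltnS.
by congr (_ * _); symmetry; apply: fps_comp_poly;
  rewrite ?ltnS ?leq_subr // => j jn; rewrite coef_fps_trunc // ltnS;
  apply: leq_trans jn _; rewrite ?leq_subr.
Qed.

Lemma fps_comp1 h : 1 \oX h = 1.
Proof.
apply/fpsP => n; rewrite /= big_ord_recl expr0 /= mul1r big1 ?addr0 //.
by move=> i _; rewrite /= mul0r.
Qed.

Lemma fps_compXn g h i : h 0%N = 0 -> (g ^+ i) \oX h = (g \oX h) ^+ i.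
Proof.
by move=> h0; elim: i => [|i IH]; rewrite ?expr0 ?fps_comp1 // !exprS fps_compM // IH.
Qed.

Lemma fps_compA f g h : g 0%N = 0 -> h 0%N = 0 ->
  (f \oX g) \oX h = f \oX (g \oX h).
Proof.
move=> g0 h0; apply/fpsP => n /=.
transitivity (\sum_(i < n.+1) \sum_(j < n.+1) f j * ((g ^+ j) i * (h ^+ i) n)).
  apply: eq_bigr => i _; rewrite mulr_suml.
  rewrite -(big_mkord xpredT (fun j => f j * (g ^+ j) i * (h ^+ i) n)).
  rewrite -(big_mkord xpredT (fun j => f j * ((g ^+ j) i * (h ^+ i) n))).
  rewrite [RHS](big_cat_nat (n := i.+1)) //=.
  rewrite [X in _ = _ + X]big_nat_cond [X in _ = _ + X]big1 ?addr0.
    by apply: eq_bigr => j _; rewrite mulrA.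
  by move=> j /andP[/andP[ij _] _]; rewrite fps_exp_lt // mul0r mulr0.
rewrite exchange_big /=; apply: eq_bigr => j _.
by rewrite -mulr_sumr -fps_compXn.
Qed.

Lemma fps_compX f : f \oX fps_X = f.
Proof.
have XnE i n : ((fps_X : fps K) ^+ i) n = (n == i)%:R.
  elim: i n => [//|i IH] n; rewrite exprS fpsE.
  case: n => [|n]; first by rewrite big_ord1 /= mul0r.
  rewrite big_ord_recl /= mul0r add0r big_ord_recl /= mul1r subSS subn0 IH.
  by rewrite big1 ?addr0 // => j _; rewrite mul0r.
apply/fpsP => n /=; rewrite big_ord_recr /= XnE eqxx mulr1 big1 ?add0r // => i _.
by rewrite XnE gtn_eqF ?mulr0.
Qed.

Lemma fps_Xcomp f : f 0%N = 0 -> fps_X \oX f = f.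
Proof.
move=> f0; apply/fpsP => -[|n] /=; first by rewrite big_ord1 mul0r f0.
rewrite big_ord_recl mul0r add0r big_ord_recl /= mul1r expr1 big1 ?addr0 //.
by move=> i _; rewrite mul0r.
Qed.

End FpsTheory.

Section FpsCompInv.
Variable K : fieldType.
Implicit Types f g h : fps K.

Lemma fps_left_comp_inv f : f 0%N = 0 -> f 1%N != 0 ->
  exists g, [/\ g 0%N = 0, g 1%N != 0 & g \oX f = fps_X].
Proof.
move=> f0 f1.
pose step n (u : nat -> K) :=
  ((n == 1%N)%:R - \sum_(i < n) u i * (f ^+ i) n) / f 1%N ^+ n.
have [|u uE] := @fps_rec K 0 step.
  move=> n u v uv; congr ((_ - _) / _); apply: eq_bigr => i _.
  by rewrite uv.
have u0 : u 0%N = 0 by rewrite uE /step big_ord0 subrr mul0r.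
exists (FPS u); split=> //=.
  rewrite uE /step big_ord1 u0 mul0r subr0 mul1r expr1.
  by rewrite invr_eq0.
apply/fpsP => n /=; rewrite big_ord_recr /= fps_exp_diag // [u n]uE /step.
by rewrite divfK ?expf_neq0 // addrC subrK.
Qed.

Lemma fps_comp_inv_ex f : f 0%N = 0 -> f 1%N != 0 ->
  exists g, [/\ g 0%N = 0, f \oX g = fps_X & g \oX f = fps_X].
Proof.
move=> f0 f1; have [g [g0 g1 gf]] := fps_left_comp_inv f0 f1.
have [h [h0 _ hg]] := fps_left_comp_inv g0 g1.
suff hf : h = f by exists g; split=> //; rewrite -hf.
by rewrite -[h]fps_compX -gf -fps_compA // hg fps_Xcomp.
Qed.

Lemma fps_comp_invP f : f 0%N = 0 -> f 1%N != 0 ->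
  [/\ fps_comp_inv f 0%N = 0, f \oX fps_comp_inv f = fps_X
    & fps_comp_inv f \oX f = fps_X].
Proof. by move=> f0 f1; exact: (xgetPex fps_X (fps_comp_inv_ex f0 f1)). Qed.

Lemma fps_compK f : f 0%N = 0 -> f 1%N != 0 -> fps_comp_inv f \oX f = fps_X.
Proof. by move=> f0 f1; case: (fps_comp_invP f0 f1). Qed.

Lemma fps_compVK f : f 0%N = 0 -> f 1%N != 0 -> f \oX fps_comp_inv f = fps_X.
Proof. by move=> f0 f1; case: (fps_comp_invP f0 f1). Qed.

Lemma fps_comp_inv_unique f g : f 0%N = 0 -> f 1%N != 0 ->
  g 0%N = 0 -> f \oX g = fps_X -> fps_comp_inv f = g.
Proof.
move=> f0 f1 g0 fg; have [h0 fh hf] := fps_comp_invP f0 f1.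
by rewrite -[LHS]fps_compX -fg -fps_compA // hf fps_Xcomp.
Qed.

Lemma in_Gamma0 q f : (1 < q)%N -> in_Gamma q f -> f 0%N = 0.
Proof. by move=> q1 [a ->] /=; rewrite big_geq // addr0. Qed.

Lemma in_Gamma1 q f : (1 < q)%N -> in_Gamma q f -> f 1%N = 1.
Proof.
move=> q1 [a ->] /=; rewrite big_mkcond big_nat1 expn1.
by rewrite ltn_eqF // addr0.
Qed.

End FpsCompInv.

(* Main.v *)
Require Import Defs.
From mathcomp Require Import all_boot all_order all_algebra.
From mathcomp Require Import boolp.
From mathcomp Require Import zify ring.

Set Implicit Arguments.
Unset Strict Implicit.
Unset Printing Implicit Defensive.

Import GRing.Theory.
Local Open Scope ring_scope.

(** Write D for the logarithmic derivative [fps_dlog], so that D[F] = X G with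
G = F' / F. In characteristic p every series gamma of Gamma_{q,K} has derivative
1, hence D[F o gamma] = X (G o gamma) ([fps_dlog_comp_Gamma]): although D is not
linear, substituting gamma acts linearly on G. It is enough to prove

  gamma o psi_q[D[F o gamma]] = psi_q[D[F]]        ([Gamma_comp_psi])

and to compose with the inverse of gamma. Compare coefficients of X^M, writing
gamma as the sum of the g_n X^n, where g_n vanishes unless n is a power of q.
When M - 1 is not in C_q both sides vanish; let M - 1 be in C_q.

- On the left, the n-th power of a series with n = q^i only has exponents
  divisible by q^i (Frobenius), so each term is g_n times the n-th power of the
  coefficient of D[F o gamma] at M / n - 1. The coefficients b of a logarithmic
  derivative satisfy b_{pj} = b_j^p ([coef_fps_dlog_pchar]), which turns this
  power into the coefficient of D[F o gamma] at M - n, that is, of G o gamma at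
  M - 1 - n. That M / n is an integer and M / n - 1 is again in C_q comes from
  the shape of C_q ([C_set_div], [coef_psi_dlog_exp]). Summing over n, the left
  side is the coefficient of X^(M-1) in gamma (G o gamma) = (X G) o gamma.

- The right side is the coefficient of X^(M-1) in D[F] = X G.

So everything rests on the fact that composition with gamma does not change the
coefficient at M - 1 of any series when M = q^N e with 1 <= e <= q
([coef_comp_Gamma]). It is the invariance of residues: dX = d(gamma), and
X^(-M) differs from gamma^(-M) by a series without polar part, so that
f(gamma) X^(-M) dX has the same residue as f(gamma) gamma^(-M) d(gamma), which
is that of f X^(-M) dX. The proof below is a direct induction on N, which peels
off one Frobenius at each step. *)

(** * Coefficients, derivatives and composition of power series *)

Section Coefficients.
Variable K : comNzRingType.
Implicit Types f g : fps K.

Lemma coef_fps_XM f n : (fps_X * f) n = if n is n'.+1 then f n' else 0.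
Proof.
case: n => [|n]; first by rewrite fpsE big_ord1 /= mul0r.
rewrite fpsE big_ord_recl /= mul0r add0r big_ord_recl /= mul1r subSS subn0.
by rewrite big1 ?addr0 // => i _; rewrite mul0r.
Qed.

Lemma coef_fps_XnM m f n :
  (fps_X ^+ m * f) n = if (m <= n)%N then f (n - m)%N else 0.
Proof.
elim: m n => [|m IH] n; first by rewrite expr0 mul1r subn0.
by rewrite exprS -mulrA coef_fps_XM; case: n => // n; rewrite IH.
Qed.

Lemma coef_fps_Xn m n : ((fps_X : fps K) ^+ m) n = (n == m)%:R.
Proof.
rewrite -[_ ^+ m]mulr1 coef_fps_XnM fpsE subn_eq0.
by case: ltngtP => // _; rewrite leqnn.
Qed.

Lemma coef_fps_sum (I : finType) (F : I -> fps K) n :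
  (\sum_i F i) n = \sum_i F i n.
Proof. exact: (big_morph (fun f : fps K => f n)). Qed.

Lemma coef_fpsMn f k n : (f *+ k) n = f n *+ k.
Proof. by elim: k => // k IH; rewrite !mulrS -IH. Qed.

Lemma fps_trunc_deriv f m : (fps_trunc m.+1 f)^`() = fps_trunc m (fps_deriv f).
Proof.
apply/polyP => i; rewrite coef_deriv !coef_poly ltnS.
by case: ifP; rewrite // mul0rn.
Qed.

Lemma fps_derivM f g :
  fps_deriv (f * g) = fps_deriv f * g + f * fps_deriv g.
Proof.
apply/fpsP => n; pose T m (h : fps K) := fps_trunc m h.
have E h : forall i, (i < n.+1)%N -> ((T n.+2 h)^`())`_i = (fps_deriv h) i.
  by move=> i ni; rewrite fps_trunc_deriv coef_fps_trunc.
have -> : (fps_deriv (f * g)) n = ((T n.+2 f * T n.+2 g)^`())`_n.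
  by rewrite coef_deriv -fps_mul_trunc.
rewrite derivM coefD !coefM !fpsE; congr (_ + _); apply: eq_bigr => i _.
  by rewrite E // coef_fps_trunc // ltnS leqW // leq_subr.
by rewrite E ?coef_fps_trunc // ?ltnS ?leq_subr // leqW // -ltnS.
Qed.

Lemma fps_deriv_comp f g : g 0%N = 0 ->
  fps_deriv (f \oX g) = (fps_deriv f \oX g) * fps_deriv g.
Proof.
move=> g0; apply/fpsP => n; pose T := @fps_trunc K n.+2.
have -> : (fps_deriv (f \oX g)) n = ((T f \Po T g)^`())`_n.
  rewrite coef_deriv -(@fps_comp_poly _ (T f) f) // => i ni.
  by rewrite coef_fps_trunc.
rewrite deriv_comp coefM fpsE; apply: eq_bigr => i _; congr (_ * _).
  rewrite -(@fps_comp_poly _ _ (fps_deriv f)) //; first exact: leqW.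
  by move=> j ji; rewrite fps_trunc_deriv coef_fps_trunc // (leq_ltn_trans ji).
by rewrite fps_trunc_deriv coef_fps_trunc // ltnS leq_subr.
Qed.

Lemma fps_unit_comp f g : g 0%N = 0 -> f \is a GRing.unit ->
  f \oX g \is a GRing.unit.
Proof. by move=> g0; rewrite !fps_unitE fps_comp0. Qed.

Lemma fps_compV f g : g 0%N = 0 -> f \is a GRing.unit ->
  f^-1 \oX g = (f \oX g)^-1.
Proof.
move=> g0 uf; apply: (mulrI (fps_unit_comp g0 uf)).
by rewrite mulrV ?fps_unit_comp // -fps_compM // mulrV // fps_comp1.
Qed.

Definition supported_dvd d f := forall n, ~~ (d %| n)%N -> f n = 0.

Lemma supported_dvd1 d : supported_dvd d 1.
Proof. by move=> n dn; rewrite fpsE; case: eqP dn => // ->; rewrite dvdn0. Qed.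

Lemma supported_dvdM d f g :
  supported_dvd d f -> supported_dvd d g -> supported_dvd d (f * g).
Proof.
move=> fd gd n dn; rewrite fpsE; apply: big1 => i _.
have [di|di] := boolP (d %| i)%N; last by rewrite fd ?mul0r.
by rewrite gd ?mulr0 // dvdn_subl // -ltnS.
Qed.

Lemma supported_dvdX k d f : supported_dvd d f -> supported_dvd d (f ^+ k).
Proof.
move=> fd; elim: k => [|k IH]; first exact: supported_dvd1.
by rewrite exprS; exact: supported_dvdM.
Qed.

End Coefficients.

(** * Frobenius *)

Section Frobenius.
Variables (p : nat) (K : comNzRingType).
Hypothesis charK : p \in [pchar K].
Implicit Types f g : fps K.

Lemma pnat_pchar_exp (R : nzRingType) s :
  p \in [pchar R] -> [pchar R].-nat (p ^ s)%N.
Proof.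
move=> pR; rewrite (eq_pnat _ (pcharf_eq pR)) pnatX pnat_id //.
exact: pcharf_prime pR.
Qed.

Lemma coef_fps_exp_pchar f s n :
  (f ^+ (p ^ s)) n = if (p ^ s %| n)%N then f (n %/ p ^ s)%N ^+ (p ^ s) else 0.
Proof.
set Q := (p ^ s)%N.
have Q0 : (0 < Q)%N by rewrite expn_gt0 prime_gt0 ?(pcharf_prime charK).
have charP : [pchar {poly K}].-nat Q.
  by apply: pnat_pchar_exp; rewrite pchar_poly.
rewrite (fps_exp_trunc _ _ (ltnSn n)) /fps_trunc poly_def.
rewrite (big_morph (fun g : {poly K} => g ^+ Q) (id1 := 0) (op1 := +%R));
  first last.
- by rewrite expr0n gtn_eqF.
- by move=> u v; rewrite exprDn_pchar.
rewrite coef_sum; case: ifPn => [/dvdnP[k nE] | nQ].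
  have -> : (n %/ Q = k)%N by rewrite nE mulnK.
  have nk i : (n == i * Q)%N = (i == k) by rewrite nE eqn_pmul2r // eq_sym.
  have kn : (k < n.+1)%N by rewrite ltnS nE leq_pmulr.
  rewrite (bigD1 (Ordinal kn)) //= exprZn -exprM coefZ coefXn nk eqxx mulr1.
  rewrite big1 ?addr0 // => i /negPf ik; rewrite exprZn -exprM coefZ coefXn nk.
  by rewrite (ik : (i : nat) == k = false) mulr0.
apply: big1 => i _; rewrite exprZn -exprM coefZ coefXn.
rewrite (_ : n == _ = false) ?mulr0 //.
by apply: contraNF nQ => /eqP ->; rewrite dvdn_mull.
Qed.

Lemma supported_dvd_pchar f s : supported_dvd (p ^ s) (f ^+ (p ^ s)).
Proof. by move=> n psn; rewrite coef_fps_exp_pchar // (negPf psn). Qed.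

End Frobenius.

(** * Logarithmic derivatives in characteristic p *)

Section LogDerivative.
Variable K : fieldType.
Implicit Types f g : fps K.

Lemma fps_unit_coef0 f : (f \is a GRing.unit) = (f 0%N != 0).
Proof.
rewrite fps_unitE; apply/asboolP/idP => [[c cf]|f0].
  by apply/eqP => f0; move/eqP: cf; rewrite f0 mulr0 eq_sym oner_eq0.
by exists (f 0%N)^-1; rewrite mulVf.
Qed.

Lemma fps_dlogE f g : f \is a GRing.unit ->
  fps_X * fps_deriv f = g * f -> fps_dlog f = g.
Proof. by move=> uf; rewrite /fps_dlog => ->; rewrite mulrK. Qed.

Lemma fps_dlogM f g : f \is a GRing.unit -> g \is a GRing.unit ->
  fps_dlog (f * g) = fps_dlog f + fps_dlog g.
Proof.
move=> uf ug; apply: fps_dlogE; first by rewrite unitrM uf.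
rewrite fps_derivM /fps_dlog; move: (mulVr uf) (mulVr ug).
move: f^-1 g^-1 => u v uf1 vg1.
transitivity
    (fps_X * fps_deriv f * g * (u * f) + fps_X * fps_deriv g * f * (v * g)).
  by rewrite uf1 vg1; ring.
by ring.
Qed.

Lemma fps_dlog_low f m n : f \is a GRing.unit ->
  (forall i, (0 < i < m)%N -> f i = 0) -> (n < m)%N -> fps_dlog f n = 0.
Proof.
move=> uf f_low nm; rewrite /fps_dlog fpsE; apply: big1 => -[i ni] _.
rewrite -[nat_of_ord _]/i coef_fps_XM; case: i ni => [|i] ni.
  by rewrite mul0r.
by rewrite /= f_low ?mul0rn ?mul0r // (leq_ltn_trans _ nm).
Qed.

Definition fps_const (c : K) : fps K := FPS (fun n => c *+ (n == 0%N)).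

Lemma coef_fps_constM c f n : (fps_const c * f) n = c * f n.
Proof.
rewrite fpsE big_ord_recl /= subn0 mulr1n big1 ?addr0 // => i _.
by rewrite mulr0n mul0r.
Qed.

Lemma coef_fps_binomialM c m f n :
  ((1 + fps_X ^+ m * fps_const c) * f) n
  = f n + (if (m <= n)%N then c * f (n - m)%N else 0).
Proof. by rewrite mulrDl mul1r -mulrA fpsE coef_fps_XnM coef_fps_constM. Qed.

Lemma coef_fps_binomial c m n : (0 < n)%N ->
  (1 + fps_X ^+ m * fps_const c) n = c *+ (n == m).
Proof.
move=> n0; rewrite fpsE coef_fps_XnM fpsE gtn_eqF // add0r.
case: ltngtP => [mn|nm|->] //; last by rewrite subnn.
by rewrite -[fps_const c _]/(c *+ (n - m == 0)%N) subn_eq0 leqNgt mn.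
Qed.

Lemma fps_unit_binomial c m : (0 < m)%N ->
  1 + fps_X ^+ m * fps_const c \is a GRing.unit.
Proof.
move=> m0; rewrite fps_unit_coef0 fpsE coef_fps_XnM leqn0 gtn_eqF // addr0.
exact: oner_neq0.
Qed.

(** D[1 + c X^m] is m c X^m / (1 + c X^m), a geometric series. *)
Lemma coef_fps_dlog_binomial c m n : (0 < m)%N -> (0 < n)%N ->
  fps_dlog (1 + fps_X ^+ m * fps_const c) n
  = if (m %| n)%N then - (- c) ^+ (n %/ m) *+ m else 0.
Proof.
move=> m0 n0.
pose g : fps K := FPS (fun i => if (0 < i)%N && (m %| i)%N
                               then - (- c) ^+ (i %/ m) *+ m else 0).
rewrite (@fps_dlogE _ g) ?fps_unit_binomial //=; first by rewrite n0.
apply/fpsP => -[|i]; rewrite coef_fps_XM [g * _]mulrC coef_fps_binomialM.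
  by rewrite leqn0 gtn_eqF // addr0.
rewrite -[fps_deriv _ i]/((1 + fps_X ^+ m * fps_const c : fps K) i.+1 *+ i.+1).
rewrite coef_fps_binomial //.
case: ltngtP => [mi|im|mE].
- have [k iE] : exists k, i.+1 = (m + k.+1)%N by exists (i - m)%N; lia.
  rewrite mulr0n mul0rn iE addKn /= dvdn_addr // -iE /= iE.
  case: dvdnP => [[j jE]|_]; last by rewrite mulr0 addr0.
  rewrite jE -mulSn !mulnK // exprS; ring.
- by rewrite mulr0n mul0rn addr0 /= gtnNdvd.
- by rewrite mE subnn /= -mE dvdnn divnn m0 expr1 opprK mulr0 addr0 mulr1n.
Qed.

Lemma coef_fps_dlog_binomial_pchar p c m n :
    p \in [pchar K] -> (0 < m)%N -> (0 < n)%N ->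
  fps_dlog (1 + fps_X ^+ m * fps_const c) (p * n)%N
  = fps_dlog (1 + fps_X ^+ m * fps_const c) n ^+ p.
Proof.
move=> charK m0 n0; have p_pr := pcharf_prime charK; have p0 := prime_gt0 p_pr.
rewrite !coef_fps_dlog_binomial ?muln_gt0 ?p0 //.
case: (boolP (m %| n)%N) => mn.
  rewrite dvdn_mull // -muln_divA // mulnC exprM.
  by rewrite -!(pFrobenius_autE charK) rmorphMn rmorphN.
rewrite expr0n gtn_eqF //; case: ifP => // mpn.
(* If m divides p n but not n then p divides m, and the factor m is 0 in K. *)
have /dvdnP[k ->] : (p %| m)%N.
  rewrite -[(_ %| _)%N]negbK -prime_coprime //; apply: contra mn => pm.
  by rewrite -(@Gauss_dvdr m p n) // coprime_sym.
by rewrite mulnC mulrnA mulrn_pchar // mul0rn.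
Qed.

(** The property is additive in D[f], hence multiplicative in f, and up to any
given order f is a constant times a finite product of factors 1 + c X^m with
increasing m, for which it can be read off the geometric series. *)
Lemma coef_fps_dlog_pchar p f n : p \in [pchar K] -> f \is a GRing.unit ->
  fps_dlog f (p * n)%N = fps_dlog f n ^+ p.
Proof.
move=> charK; have p_pr := pcharf_prime charK; have p0 := prime_gt0 p_pr.
have [->|n0] := posnP n.
  by move=> uf; rewrite muln0 /fps_dlog -mulrA coef_fps_XM expr0n gtn_eqF.
(* d bounds the number of factors still to be split off: they only matter for
   exponents m <= p n. *)
suff H d m : (0 < m)%N -> (p * n < m + d)%N -> f \is a GRing.unit ->
    (forall i, (0 < i < m)%N -> f i = 0) ->
    fps_dlog f (p * n)%N = fps_dlog f n ^+ p.
  by move=> uf; apply: (H (p * n)%N 1%N) => // -[|[]].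
elim: d m f => [|d IH] m f m0 pn uf f_low.
  rewrite addn0 in pn; rewrite !(fps_dlog_low uf f_low) ?expr0n ?gtn_eqF //.
  by rewrite (leq_ltn_trans _ pn) // leq_pmull.
pose B := 1 + fps_X ^+ m * fps_const (f m / f 0%N).
have uB : B \is a GRing.unit := fps_unit_binomial _ m0.
have fE : f = B * (f / B) by rewrite mulrC mulrVK.
have ufB : f / B \is a GRing.unit by rewrite unitrM uf unitrV.
have coefE i := congr1 (fun h : fps K => h i) fE.
have coef_lt i : (i < m)%N -> (f / B) i = f i.
  by move=> im; rewrite [RHS]coefE coef_fps_binomialM leqNgt im addr0.
rewrite fE fps_dlogM // fpsE coef_fps_dlog_binomial_pchar //.
rewrite (IH m.+1 (f / B)) ?addSnnS // => [|i /andP[i0]].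
  by rewrite fpsE -!(pFrobenius_autE charK) rmorphD.
rewrite ltnS leq_eqVlt => /predU1P[->|im]; last first.
  by rewrite coef_lt // f_low // i0.
have := coefE m; rewrite coef_fps_binomialM leqnn subnn (coef_lt 0%N) //.
rewrite mulfVK -?fps_unit_coef0 // => /esym/(canRL (addrK _)) ->.
exact: subrr.
Qed.

Lemma coef_fps_dlog_pchar_exp p f s n :
    p \in [pchar K] -> f \is a GRing.unit ->
  fps_dlog f (p ^ s * n)%N = fps_dlog f n ^+ (p ^ s).
Proof.
move=> charK uf; elim: s n => [|s IH] n; first by rewrite mul1n.
by rewrite expnS -mulnA coef_fps_dlog_pchar // IH -exprM mulnC.
Qed.

End LogDerivative.

(** * The set C_q and the projection psi_q *)

Lemma coef_psi p q (K : comNzRingType) (f : fps K) n :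
  psi p q f n = if n is k.+1 then if `[< C_set p q k >] then f k else 0 else 0.
Proof. by rewrite /psi coef_fps_XM; case: n. Qed.

Section CSet.
Variables p q : nat.
Hypothesis q1 : (1 < q)%N.

Let qX0 i : (0 < q ^ i)%N. Proof. by rewrite expn_gt0 (ltnW q1). Qed.

Lemma C_set_neq0 k : C_set p q k -> (0 < k)%N.
Proof.
case=> c [i [[/andP[c0 _] _ _] ->]]; rewrite subn_gt0.
by apply: (leq_trans (n := c.+1)); rewrite ?ltnS // leq_pmull // qX0.
Qed.

(** Since k + 1 = q^N (c + 1) with c + 1 <= q, a power of q less than k + 1 is
at most q^N. *)
Lemma C_set_div k i : C_set p q k -> (q ^ i < k.+1)%N ->
  exists2 j, C_set p q j & k.+1 = (q ^ i * j.+1)%N.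
Proof.
case=> c [N [C0c kE]].
have kS : k.+1 = (q ^ N * c.+1)%N by rewrite kE subn1 prednK // muln_gt0 qX0.
have [/andP[_ cq] _ _] := C0c; rewrite {}kS => iq.
have iN : (i <= N)%N.
  rewrite -ltnS -(ltn_exp2l _ _ q1).
  by rewrite (leq_trans iq) // expnSr leq_pmul2l.
exists (q ^ (N - i) * c.+1 - 1)%N; first by exists c, (N - i)%N.
by rewrite subn1 prednK ?muln_gt0 ?qX0 // mulnA -expnD subnKC.
Qed.

Lemma C_set_mul i j k : C_set p q j -> k.+1 = (q ^ i * j.+1)%N -> C_set p q k.
Proof.
case=> c [N [C0c jE]] kS; exists c, (i + N)%N; split=> //.
have jS : j.+1 = (q ^ N * c.+1)%N by rewrite jE subn1 prednK // muln_gt0 qX0.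
by rewrite expnD -mulnA -jS -kS subn1.
Qed.

End CSet.

(** * Composition with an element of Gamma_{q,K} *)

Section Gamma.
Variables (p s : nat) (K : fieldType).
Hypotheses (charK : p \in [pchar K]) (s0 : (0 < s)%N).
Local Notation q := (p ^ s)%N.
Variable gamma : fps K.
Hypothesis gammaP : in_Gamma q gamma.

Let p_pr : prime p. Proof. exact: pcharf_prime charK. Qed.
Let q1 : (1 < q)%N. Proof. by rewrite -(exp1n s) ltn_exp2r ?prime_gt1. Qed.
Let q0 : (0 < q)%N. Proof. exact: ltnW. Qed.
Let qX0 i : (0 < q ^ i)%N. Proof. by rewrite expn_gt0 q0. Qed.

Lemma Gamma_support n : gamma n = 0 \/ exists i, n = (q ^ i)%N.
Proof.
have [a ->] := gammaP.
case: (pselect (exists i, n = (q ^ i)%N)); first by right.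
move=> nq; left; rewrite big1 ?addr0 => [|i /eqP nE].
  by rewrite /=; case: eqP => // n1; case: nq; exists 0%N.
by case: nq; exists i.
Qed.

Lemma Gamma_support_dvd n : n != 1%N -> ~~ (q %| n)%N -> gamma n = 0.
Proof.
move=> n1 qn; have [//|[[|i] nE]] := Gamma_support n.
  by rewrite nE in n1.
by rewrite nE expnS dvdn_mulr in qn.
Qed.

Lemma fps_deriv_Gamma : fps_deriv gamma = 1.
Proof.
apply/fpsP => -[|n] /=; first exact: in_Gamma1 gammaP.
have [/dvdnP[k ->]|pn] := boolP (p %| n.+2)%N.
  by rewrite mulrnA mulrn_pchar.
rewrite Gamma_support_dvd ?mul0rn //; apply: contra pn.
by apply: dvdn_trans; rewrite dvdn_exp.
Qed.

Lemma fps_dlog_comp_Gamma (F : fps K) : F \is a GRing.unit ->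
  fps_dlog (F \oX gamma) = fps_X * ((fps_deriv F / F) \oX gamma).
Proof.
move=> uF; have g0 := in_Gamma0 q1 gammaP.
rewrite /fps_dlog fps_deriv_comp // fps_deriv_Gamma mulr1 -mulrA.
by rewrite fps_compM // fps_compV.
Qed.

(** Modulo series in X^q, gamma is X. In the binomial expansion of
(X + S)^r, with S = gamma - X a series in X^q, an exponent congruent to -1
modulo q therefore needs at least q - 1 factors X. *)
Lemma coef_mul_Gamma_exp f r M : supported_dvd q f -> (r < q)%N -> (0 < M)%N ->
  (f * gamma ^+ r) (q * M).-1 =
    if r == q.-1 then f (q * M.-1)%N else 0.
Proof.
move=> fq rq M0.
pose S := gamma - fps_X.
have Sq : supported_dvd q S.
  move=> n qn; rewrite !fpsE; have [->|n1] := eqVneq n 1%N.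
    by rewrite (in_Gamma1 q1 gammaP) subrr.
  by rewrite Gamma_support_dvd // /= (negPf n1) subrr.
have -> : gamma = fps_X + S by rewrite addrC subrK.
have qM : (q * M).-1 = (q * M.-1 + q.-1)%N by case: M M0 => //= M _; lia.
have term j : (j <= r)%N ->
    (fps_X ^+ (r - j) * (f * S ^+ j)) (q * M).-1 =
      if (r - j == q.-1)%N then (f * S ^+ j) (q * M.-1)%N else 0.
  move=> jr; rewrite coef_fps_XnM.
  have rjq : (r - j <= q.-1)%N by lia.
  rewrite ifT; last by rewrite qM (leq_trans rjq) ?leq_addl.
  case: eqP => [->|ne]; first by rewrite qM addnK.
  have fS := supported_dvdM fq (supported_dvdX j Sq).
  rewrite fS // qM -addnBA // dvdn_addr ?dvdn_mulr // gtnNdvd //; lia.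
rewrite exprDn mulr_sumr coef_fps_sum.
have E (i : 'I_r.+1) :
    (f * (fps_X ^+ (r - i) * S ^+ i *+ 'C(r, i))) (q * M).-1 =
    (if (r - i == q.-1)%N then (f * S ^+ i) (q * M.-1)%N else 0) *+ 'C(r, i).
  by rewrite mulrnAr coef_fpsMn mulrCA term // -ltnS.
rewrite (eq_bigr _ (fun i _ => E i)) big_ord_recl -[nat_of_ord ord0]/0%N.
rewrite subn0 bin0 mulr1n expr0 mulr1.
rewrite big1 ?addr0 // => i _; rewrite ifF ?mul0rn //; apply/eqP.
by rewrite lift0; have := ltn_ord i; lia.
Qed.

(** For N = 0 the exponent is less than q, and gamma is X up to X^q. For N > 0,
write m = q a + r with r < q: gamma^m is (gamma^a)^q, a series in X^q, times
gamma^r, so the previous lemma forces r = q - 1 and leaves a q-th power of a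
coefficient of gamma^a at an exponent of the same form for N - 1. *)
Lemma coef_Gamma_exp N e m : (0 < e <= q)%N ->
  (gamma ^+ m) (q ^ N * e).-1 = (m == (q ^ N * e).-1)%:R.
Proof.
case/andP=> e0 e_le_q; elim: N m => [|N IH] m.
  have e1q : (e.-1 < q)%N by rewrite prednK.
  rewrite mul1n eq_sym -(coef_fps_Xn K m) !(fps_exp_trunc _ _ e1q).
  congr ((_ ^+ _ : {poly K})`_ _); apply/polyP => i; rewrite !coef_poly.
  case: ltnP => // iq.
  have [->|i1] := eqVneq i 1%N; first by rewrite (in_Gamma1 q1 gammaP).
  rewrite /= (negPf i1); case: i i1 iq => [|i] i1 iq.
    by rewrite (in_Gamma0 q1 gammaP).
  by rewrite Gamma_support_dvd // gtnNdvd.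
have M0 : (0 < q ^ N * e)%N by rewrite muln_gt0 qX0.
rewrite expnS -mulnA {1}(divn_eq m q) exprD exprM.
rewrite coef_mul_Gamma_exp ?ltn_pmod //; last exact: supported_dvd_pchar.
set M := (q ^ N * e)%N in M0 IH *.
have qM : (q * M).-1 = (M.-1 * q + q.-1)%N by case: (M) M0 => //= k _; lia.
rewrite coef_fps_exp_pchar // dvdn_mulr // mulKn // IH -/M.
(* q M - 1 has remainder q - 1 and quotient M - 1 modulo q. *)
have -> : (m == (q * M).-1) = (m %% q == q.-1)%N && (m %/ q == M.-1)%N.
  rewrite qM; apply/eqP/andP => [->|[/eqP <- /eqP <-]]; last exact: divn_eq.
  have qq : (q.-1 < q)%N by rewrite prednK.
  by rewrite modnMDl divnMDl // modn_small // divn_small // addn0.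
by case: (_ == q.-1) => //=; case: eqP => _; rewrite ?expr1n // expr0n gtn_eqF.
Qed.

Lemma coef_comp_Gamma f N e : (0 < e <= q)%N ->
  (f \oX gamma) (q ^ N * e).-1 = f (q ^ N * e).-1.
Proof.
move=> he; rewrite /= big_ord_recr /= coef_Gamma_exp // eqxx mulr1.
rewrite big1 ?add0r // => i _.
by rewrite coef_Gamma_exp // ltn_eqF ?mulr0.
Qed.

(** If k + 1 = q^i (j + 1) with j in C_q, the power is that of the coefficient
of D[F] at j, which by Frobenius is its coefficient at q^i j = k + 1 - q^i. In
all other cases both sides vanish because C_q is closed under
j |-> q^i (j + 1) - 1 and under its inverse. *)
Lemma coef_psi_dlog_exp (F : fps K) k i :
    F \is a GRing.unit -> (q ^ i < k.+1)%N ->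
  (psi p q (fps_dlog F) ^+ (q ^ i)) k.+1 =
    if `[< C_set p q k >] then fps_dlog F (k.+1 - q ^ i)%N else 0.
Proof.
move=> uF ik; rewrite -expnM coef_fps_exp_pchar // expnM.
case: asboolP => [Ck|nCk].
  have [j Cj kE] := C_set_div q1 Ck ik.
  rewrite kE dvdn_mulr // mulKn ?qX0 // coef_psi ifT; last exact/asboolP.
  by rewrite -expnM -coef_fps_dlog_pchar_exp // expnM mulnS addKn.
case: dvdnP => // -[j kE]; rewrite kE mulnK ?qX0 // coef_psi.
case: j kE => [|j] kE; last case: asboolP => [Cj|_].
- by rewrite expr0n gtn_eqF // qX0.
- by case: nCk; apply: (C_set_mul q1 (i := i) Cj); rewrite kE mulnC.
- by rewrite expr0n gtn_eqF // qX0.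
Qed.

(** The term of index n in gamma o psi_q[D[F o gamma]] matches the term of
index n in the product gamma (G o gamma), which is (X G) o gamma; the
coefficient of the latter at k in C_q is that of X G = D[F]. *)
Lemma Gamma_comp_psi (F : fps K) : F \is a GRing.unit ->
  gamma \oX psi p q (fps_dlog (F \oX gamma)) = psi p q (fps_dlog F).
Proof.
move=> uF; have g0 := in_Gamma0 q1 gammaP.
have uFg : F \oX gamma \is a GRing.unit by exact: fps_unit_comp.
set P := psi p q _; pose G := fps_deriv F / F.
have dE : fps_dlog (F \oX gamma) = fps_X * (G \oX gamma).
  exact: fps_dlog_comp_Gamma.
apply/fpsP => -[|k]; first by rewrite fps_comp0 g0 coef_psi.
rewrite -[LHS]/(\sum_(n < k.+2) gamma n * (P ^+ n) k.+1).
rewrite big_ord_recr -[nat_of_ord ord_max]/k.+1.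
(* The extra term n = k + 1 only sees the linear coefficient of P, which is 0
   because 0 is not in C_q. *)
have -> : (P ^+ k.+1) k.+1 = 0.
  rewrite fps_exp_diag ?coef_psi //; case: asboolP => [/(C_set_neq0 q1) //|_].
  by rewrite expr0n.
rewrite mulr0 [LHS]addr0.
have term (n : 'I_k.+1) : gamma n * (P ^+ n) k.+1 =
    if `[< C_set p q k >] then gamma n * (G \oX gamma) (k - n)%N else 0.
  have [->|[i nE]] := Gamma_support n; first by rewrite !mul0r if_same.
  have ik : (q ^ i < k.+1)%N by rewrite -nE.
  rewrite nE coef_psi_dlog_exp // dE coef_fps_XM subSn //.
  by case: ifP => _; rewrite // mulr0.
rewrite (eq_bigr _ (fun n _ => term n)) coef_psi.
case: asboolP => [[c [N [[/andP[_ cq] _ _] kE]]]|_]; last by rewrite big1.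
rewrite -[LHS]/((gamma * (G \oX gamma)) k).
rewrite -[X in X * _](fps_Xcomp g0) -fps_compM //.
rewrite kE subn1 coef_comp_Gamma //.
by rewrite /fps_dlog -mulrA.
Qed.

End Gamma.

Theorem theorem1p3 (p lambda q : nat) (K : fieldType)
    (p_prime : prime p) (charK : p \in [pchar K])
    (lambda_ge1 : (1 <= lambda)%N) (qE : q = (p ^ lambda)%N)
    (gamma : fps K) (gammaP : in_Gamma q gamma)
    (F : fps K) (F_unit : F \is a GRing.unit) :
  psi p q (fps_dlog (F \oX gamma))
  = fps_comp_inv gamma \oX psi p q (fps_dlog F).
Proof.
subst q.
have q1 : (1 < p ^ lambda)%N by rewrite -(exp1n lambda) ltn_exp2r ?prime_gt1.
have g0 := in_Gamma0 q1 gammaP.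
have g1 : gamma 1%N != 0 by rewrite (in_Gamma1 q1 gammaP) oner_neq0.
have psi0 (f : fps K) : psi p (p ^ lambda) f 0%N = 0 by rewrite coef_psi.
rewrite -(Gamma_comp_psi charK lambda_ge1 gammaP F_unit) -fps_compA //.
by rewrite fps_compK // fps_Xcomp.
Qed.
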